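(* Suppose $\mathcal{A}*\mathcal{X}=\mathcal{B}$ is consistent, and run the Gram-Schmidt-based TKGK algorithm with truncation parameter $\tau=\infty$ and with the incremental or the shuffle-once permutation strategy (so $\pi_k=\pi_0$ for all $k$). Let $\mathcal{C}_{\pi_0}:=\mathcal{I}-\mathcal{T}_{\pi_0}$, and let $k\ge0$ be such that the algorithm has not stopped before producing $\mathcal{U}_{k+1}$. Then $$\mathcal{C}_{\pi_0}*\mathcal{U}_k=\sum_{i=0}^{k}\frac{\langle\mathcal{U}_i,\mathcal{C}_{\pi_0}*\mathcal{U}_k\rangle}{\|\mathcal{U}_i\|_F^2}\,\mathcal{U}_i-\frac1{\lambda_k}\,\mathcal{U}_{k+1}.$$ Consequently, with $\mathcal{U}^k:=[\mathcal{U}_0,\dots,\mathcal{U}_k]\in\mathbb{R}^{\ell\times(k+1)p\times n}$ and $\mathcal{R}_k:=-\frac{1}{\lambda_k}\,\mathcal{U}_{k+1}$, one has the tensor Arnoldi decomposition $$\mathcal{C}_{\pi_0}*\mathcal{U}^k=\mathcal{U}^k*\mathcal{H}_k+\mathcal{R}_k*\mathcal{E}_k^\top .$$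
   Context: Tensor notation. For $\mathcal{A}\in\mathbb{R}^{m\times \ell\times n}$ let $A_1,\dots,A_n$ be its frontal slices. $\operatorname{bcirc}(\mathcal{A})\in\mathbb{R}^{mn\times \ell n}$ is the block circulant matrix whose first block column is $A_1,\dots,A_n$ (top to bottom) and whose $(i,j)$ block is $A_{((i-j) \bmod n)+1}$. $\operatorname{unfold}(\mathcal{A})\in\mathbb{R}^{mn\times \ell}$ stacks $A_1,\dots,A_n$ vertically, and $\operatorname{fold}$ is its inverse. The $t$-product is $\mathcal{A} * \mathcal{Y} = \operatorname{fold}(\operatorname{bcirc}(\mathcal{A})\operatorname{unfold}(\mathcal{Y}))$. $\mathcal{A}^\dagger$ is the tensor with $\operatorname{bcirc}(\mathcal{A}^\dagger)=\operatorname{bcirc}(\mathcal{A})^\dagger$ (Moore-Penrose), $\mathcal{A}^\top$ the tensor with $\operatorname{bcirc}(\mathcal{A}^\top)=\operatorname{bcirc}(\mathcal{A})^\top$. $\mathcal{I}$ is the identity tensor (first frontal slice the identity matrix, others zero). $\langle\cdot,\cdot\rangle$ is the entrywise inner product, $\|\cdot\|_F$ the induced norm. $\mathcal{A}_{i::}\in\mathbb{R}^{1\times \ell\times n}$ is the $i$th horizontal slice. Problem: $\mathcal{A}\in\mathbb{R}^{m\times\ell\times n}$, $\mathcal{B}\in\mathbb{R}^{m\times p\times n}$, unknown $\mathcal{X}\in\mathbb{R}^{\ell\times p\times n}$. Projections. $\mathcal{P}_i(\mathcal{X}) = \mathcal{X} - \mathcal{A}_{i::}^\dagger * (\mathcal{A}_{i::}*\mathcal{X}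 - \mathcal{B}_{i::})$. For a permutation $\pi_k=(\pi_{k,1},\dots,\pi_{k,m})$ of $\{1,\dots,m\}$, $\mathcal{P}_{\pi_k} = \mathcal{P}_{\pi_{k,m}}\circ\cdots\circ\mathcal{P}_{\pi_{k,1}}$, $$\mathcal{T}_{\pi_k} = (\mathcal{I} - \mathcal{A}_{\pi_{k,m}::}^\dagger * \mathcal{A}_{\pi_{k,m}::}) * \cdots * (\mathcal{I} - \mathcal{A}_{\pi_{k,1}::}^\dagger * \mathcal{A}_{\pi_{k,1}::}),$$ and $r_{\pi_k}(\mathcal{X})\in\mathbb{R}^{mn\ell\times p}$ is the vertical stacking over $i=1,\dots,m$ of the blocks $$\operatorname{unfold}\big(\mathcal{A}_{\pi_{k,i}::}^\dagger * (\mathcal{A}_{\pi_{k,i}::} * (\mathcal{P}_{\pi_{k,i-1}}\circ\cdots\circ\mathcal{P}_{\pi_{k,1}})(\mathcal{X}) - \mathcal{B}_{\pi_{k,i}::})\big)$$ (for $i=1$ the composition is the identity). Permutation strategies: incremental: $\pi_k=(1,\dots,m)$ for all $k$; shuffle-once: one random permutation $\pi_0$ drawn at the start and $\pi_k=\pi_0$ for all $k$. Gram-Schmidt-based TKGK algorithm with $\tau=\infty$ (all previous directions used). Given $\mathcal{X}^0\in\mathbb{R}^{\ell\times p\times n}$, compute $\mathcal{D}_0=\mathcal{P}_{\pi_0}(\mathcal{X}^0)-\mathcal{X}^0$; stop if $\mathcal{D}_0=0$, otherwise set $\mathcal{U}_0=\mathcal{D}_0$. For $k=0,1,\dots$: set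 $\gamma_k=\tfrac12(\|r_{\pi_k}(\mathcal{X}^k)\|_F^2+\|\mathcal{D}_k\|_F^2)$, $\lambda_k=\gamma_k/\|\mathcal{U}_k\|_F^2$, $\mathcal{X}^{k+1}=\mathcal{X}^k+\lambda_k\,\mathcal{U}_k$, $\mathcal{D}_{k+1}=\mathcal{P}_{\pi_{k+1}}(\mathcal{X}^{k+1})-\mathcal{X}^{k+1}$; stop if $\mathcal{D}_{k+1}=0$, otherwise set $$\mathcal{U}_{k+1}=\mathcal{D}_{k+1}-\sum_{i=0}^{k}\frac{\langle\mathcal{U}_i,\mathcal{D}_{k+1}\rangle}{\|\mathcal{U}_i\|_F^2}\,\mathcal{U}_i .$$ Arnoldi objects. $[\mathcal{U}_0,\dots,\mathcal{U}_k]$ denotes concatenation along the second mode. $\mathcal{E}_k\in\mathbb{R}^{(k+1)p\times p\times n}$ has first frontal slice $e_{k+1}\otimes I_p$ ($e_{k+1}$ the last standard basis vector of $\mathbb{R}^{k+1}$, $\otimes$ Kronecker product) and all other frontal slices zero. $\mathcal{H}_k\in\mathbb{R}^{(k+1)p\times(k+1)p\times n}$ has first frontal slice $H_k\otimes I_p$ and all others zero, where $H_k\in\mathbb{R}^{(k+1)\times(k+1)}$ is the upper Hessenberg matrix with $$h_{i,j}=\frac{\langle\mathcal{U}_{i-1},\mathcal{C}_{\pi_0}*\mathcal{U}_{j-1}\rangle}{\|\mathcal{U}_{i-1}\|_F^2}\ (1\le i\le j\le k+1),\qquad h_{j+1,j}=-\frac1{\lambda_{j-1}}\ (1\le j\le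 k),$$ and all other entries zero. *)

(* Defs.v *)
From HB Require Import structures.
From mathcomp Require Import all_boot all_order all_algebra all_fingroup.

Set Implicit Arguments.
Unset Strict Implicit.
Unset Printing Implicit Defensive.

Import Order.TTheory GRing.Theory Num.Theory.
Local Open Scope ring_scope.

(* [A t] is the (t+1)-st frontal slice. Operations that need the cyclic      *)
(* structure of the slice indices take [n.+1] slices, where subtraction in   *)
(* ['I_n.+1] is subtraction modulo [n.+1].                                   *)
Notation tensor R m l n := {ffun 'I_n -> 'M[R]_(m, l)}.

Section MoorePenrose.
Variable R : rcfType.

Definition is_pinv a b (M : 'M[R]_(a, b)) (X : 'M[R]_(b, a)) : bool :=
  [&& M *m X *m M == M, X *m M *m X == X,
      (M *m X)^T == M *m X & (X *m M)^T == X *m M].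

Lemma is_pinv_inj a b (M : 'M[R]_(a, b)) X Y :
  is_pinv M X -> is_pinv M Y -> X = Y.
Proof.
move=> /and4P[/eqP X1 /eqP X2 /eqP X3 /eqP X4].
move=> /and4P[/eqP Y1 /eqP Y2 /eqP Y3 /eqP Y4].
have eMX : M *m X = M *m Y.
  by rewrite -X3 -{1}Y1 -mulmxA trmx_mul X3 Y3 mulmxA X1.
have eXM : X *m M = Y *m M.
  by rewrite -X4 -{1}Y1 -[M *m Y *m M]mulmxA mulmxA trmx_mul X4 Y4
             -mulmxA [M *m _]mulmxA X1.
by rewrite -X2 eXM -mulmxA eMX mulmxA Y2.
Qed.

Lemma gram_unit a b (M : 'M[R]_(a, b)) : row_free M -> M *m M^T \in unitmx.
Proof.
move=> Mfree; rewrite -row_free_unit -kermx_eq0; apply/eqP/row_matrixP => i.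
rewrite row0; set v := row i _.
have vG : v *m (M *m M^T) = 0 by rewrite /v -row_mul mulmx_ker row0.
have /eqP : (v *m M) *m (v *m M)^T = 0.
  by rewrite trmx_mul mulmxA -(mulmxA v) vG mul0mx.
rewrite (_ : _ *m _ = (\sum_j (v *m M) 0 j ^+ 2)%:M); last first.
  apply/matrixP=> x y; rewrite !ord1 !mxE eqxx mulr1n.
  by apply: eq_bigr => j _; rewrite [_^T _ _]mxE expr2.
move=> /eqP/matrixP/(_ 0 0); rewrite !mxE eqxx mulr1n => /eqP.
rewrite psumr_eq0; last by move=> j _; exact: sqr_ge0.
move=> /allP w0; apply/(row_free_inj Mfree); rewrite mul0mx.
apply/rowP=> j; rewrite [RHS]mxE; apply/eqP.
by rewrite -sqrf_eq0; apply: w0; rewrite mem_index_enum.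
Qed.

Lemma pinv_exists a b (M : 'M[R]_(a, b)) : exists X, is_pinv M X.
Proof.
have [r [C [W [-> Wfree Cfull]]]] : exists r (C : 'M[R]_(a, r)) (W : 'M[R]_(r, b)),
    [/\ M = C *m W, row_free W & row_free C^T].
  exists (\rank M), (col_base M), (row_base M); rewrite mulmx_base row_base_free.
  by split=> //; rewrite /row_free mxrank_tr; have := col_base_full M.
have WU : W *m W^T \in unitmx by exact: gram_unit.
have CU : C^T *m C \in unitmx by rewrite -{2}[C]trmxK; exact: gram_unit.
set X := W^T *m invmx (W *m W^T) *m (invmx (C^T *m C) *m C^T).
have MX : C *m W *m X = C *m (invmx (C^T *m C) *m C^T).
  by rewrite /X -!mulmxA !(mulmxA W) (mulmxA (W *m W^T)) mulmxV // mul1mx.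
have XM : X *m (C *m W) = W^T *m invmx (W *m W^T) *m W.
  by rewrite /X -!mulmxA !(mulmxA C^T) (mulmxA (invmx (C^T *m C)))
             mulVmx // mul1mx.
exists X; apply/and4P; split; apply/eqP.
- by rewrite MX -!mulmxA !(mulmxA C^T) (mulmxA (invmx _)) mulVmx // mul1mx.
- by rewrite XM /X -!mulmxA !(mulmxA W) (mulmxA (W *m W^T)) mulmxV // mul1mx.
- by rewrite MX !trmx_mul trmxK trmx_inv trmx_mul trmxK mulmxA.
- by rewrite XM !trmx_mul trmxK trmx_inv trmx_mul trmxK mulmxA.
Qed.

Definition pinv a b (M : 'M[R]_(a, b)) : 'M[R]_(b, a) := xchoose (pinv_exists M).

Lemma pinvP a b (M : 'M[R]_(a, b)) : is_pinv M (pinv M).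
Proof. exact: xchooseP. Qed.

End MoorePenrose.

Section Tensor.
Variable R : rcfType.

Definition bcirc m l n (A : tensor R m l n.+1) :
    'M[R]_(\sum_(i < n.+1) m, \sum_(j < n.+1) l) :=
  \mxblock_(i < n.+1, j < n.+1) A (i - j).

Definition unfold m l n (A : tensor R m l n) : 'M[R]_(\sum_(i < n) m, l) :=
  \mxcol_(i < n) A i.

Definition fold m l n (M : 'M[R]_(\sum_(i < n) m, l)) : tensor R m l n :=
  [ffun i => submxcol M i].

Lemma unfoldK m l n : cancel (@unfold m l n) (@fold m l n).
Proof. by move=> A; apply/ffunP=> i; rewrite ffunE mxcolK. Qed.

Lemma foldK m l n : cancel (@fold m l n) (@unfold m l n).
Proof.
by move=> M; rewrite -[RHS]submxcolK; apply: eq_mxcol => i; rewrite ffunE.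
Qed.

Definition tprod m l p n (A : tensor R m l n.+1) (Y : tensor R l p n.+1) :
    tensor R m p n.+1 :=
  fold (bcirc A *m unfold Y).

Definition tid l n : tensor R l l n.+1 := [ffun t => if t == 0 then 1%:M else 0].

Definition ttr m l n (A : tensor R m l n.+1) : tensor R l m n.+1 :=
  [ffun t => (A (- t))^T].

Lemma bcirc_ttr m l n (A : tensor R m l n.+1) : bcirc (ttr A) = (bcirc A)^T.
Proof.
by rewrite /bcirc tr_mxblock; apply: eq_mxblock => i j; rewrite ffunE opprB.
Qed.

Lemma bcirc_inj m l n : injective (@bcirc m l n).
Proof.
move=> A B eAB; apply/ffunP=> i.
have /(congr1 (fun M => submxblock M i 0)) := eAB.
by rewrite !mxblockK subr0.
Qed.

(* simultaneous cyclic shift of block rows and block columns *)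
Let shift m l n (t : 'I_n.+1) (M : 'M[R]_(\sum_(i < n.+1) m, \sum_(j < n.+1) l)) :
    'M[R]_(\sum_(i < n.+1) m, \sum_(j < n.+1) l) :=
  \mxblock_(i, j) submxblock M (i + t) (j + t).

Let shiftM m l p n (t : 'I_n.+1)
    (M : 'M[R]_(\sum_(i < n.+1) m, \sum_(j < n.+1) l))
    (N : 'M[R]_(\sum_(i < n.+1) l, \sum_(j < n.+1) p)) :
  shift t (M *m N) = shift t M *m shift t N.
Proof.
rewrite /shift mul_mxblock; apply: eq_mxblock => i j.
rewrite -{1}[M]submxblockK -{1}[N]submxblockK mul_mxblock mxblockK.
by rewrite (reindex_inj (addIr t)).
Qed.

Let shiftT m l n (t : 'I_n.+1)
    (M : 'M[R]_(\sum_(i < n.+1) m, \sum_(j < n.+1) l)) :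
  shift t M^T = (shift t M)^T.
Proof.
rewrite /shift tr_mxblock; apply: eq_mxblock => i j.
by apply/matrixP=> x y; rewrite !mxE.
Qed.

Let shift_bcirc m l n t (A : tensor R m l n.+1) : shift t (bcirc A) = bcirc A.
Proof.
apply: eq_mxblock => i j.
by rewrite mxblockK (_ : i + t - (j + t) = i - j) // opprD addrACA subrr addr0.
Qed.

Lemma tpinv_exists m l n (A : tensor R m l n.+1) :
  exists Y : tensor R l m n.+1, bcirc Y == pinv (bcirc A).
Proof.
set X := pinv (bcirc A).
have shX t : shift t X = X.
  apply: (@is_pinv_inj _ _ _ (bcirc A)); last exact: pinvP.
  have /and4P[/eqP X1 /eqP X2 /eqP X3 /eqP X4] := pinvP (bcirc A).
  rewrite -(shift_bcirc t A) /is_pinv -!shiftM -!shiftT.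
  by rewrite X1 X2 X3 X4 !eqxx.
exists [ffun i => submxblock X i 0]; apply/eqP.
rewrite -[RHS]submxblockK; apply: eq_mxblock => i j; rewrite ffunE.
by rewrite -{1}(shX j) mxblockK subrK add0r.
Qed.

Definition tpinv m l n (A : tensor R m l n.+1) : tensor R l m n.+1 :=
  xchoose (tpinv_exists A).

Lemma bcirc_tpinv m l n (A : tensor R m l n.+1) :
  bcirc (tpinv A) = pinv (bcirc A).
Proof. exact/eqP/(xchooseP (tpinv_exists A)). Qed.

Definition mxdot a b (M N : 'M[R]_(a, b)) : R := \sum_i \sum_j M i j * N i j.
Definition mxnorm a b (M : 'M[R]_(a, b)) : R := Num.sqrt (mxdot M M).

Definition tdot m l n (X Y : tensor R m l n) : R := \sum_t mxdot (X t) (Y t).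
Definition tnorm m l n (X : tensor R m l n) : R := Num.sqrt (tdot X X).

Definition hslice m l n (A : tensor R m l n) (i : 'I_m) : tensor R 1 l n :=
  [ffun t => row i (A t)].

End Tensor.

Section Algorithm.
Variables (R : rcfType) (m l p n : nat).
Variables (A : tensor R m l n.+1) (B : tensor R m p n.+1).
Implicit Types (s : 'S_m) (X : tensor R l p n.+1).

Definition proj (i : 'I_m) X : tensor R l p n.+1 :=
  X - tprod (tpinv (hslice A i)) (tprod (hslice A i) X - hslice B i).

(* the first [j] projections in the order [s 0, s 1, ...]; the identity for [j = 0] *)
Definition proj_upto s (j : nat) X : tensor R l p n.+1 :=
  foldl (fun Y i => proj i Y) X (take j [seq s i | i <- enum 'I_m]).

Definition proj_perm s X : tensor R l p n.+1 := proj_upto s m X.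

(* [rev_ord i] makes the factor of [s (m - 1)] the leftmost one *)
Definition Tperm s : tensor R l l n.+1 :=
  \big[@tprod R l l l n / tid R l n]_(i < m)
    (tid R l n - tprod (tpinv (hslice A (s (rev_ord i)))) (hslice A (s (rev_ord i)))).

Definition rperm s X : 'M[R]_(\sum_(i < m) \sum_(t < n.+1) l, p) :=
  \mxcol_(i < m) unfold (tprod (tpinv (hslice A (s i)))
    (tprod (hslice A (s i)) (proj_upto s i X) - hslice B (s i))).

(* The iteration with no truncation, carried on without stopping at least    *)
(* until [U K] is produced. Nothing is said about later indices.             *)
Record tkgk_run (X0 : tensor R l p n.+1) (pi : nat -> 'S_m) (K : nat)
    (X D U : nat -> tensor R l p n.+1) (lambda : nat -> R) : Prop := TkgkRun {
  tkgk_X0 : X 0%N = X0;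
  tkgk_D : forall k, (k <= K)%N -> D k = proj_perm (pi k) (X k) - X k;
  tkgk_nostop : forall k, (k <= K)%N -> D k != 0;
  tkgk_U0 : U 0%N = D 0%N;
  tkgk_lambda : forall k, (k < K)%N ->
    lambda k = 2^-1 * (mxnorm (rperm (pi k) (X k)) ^+ 2 + tnorm (D k) ^+ 2)
               / tnorm (U k) ^+ 2;
  tkgk_XS : forall k, (k < K)%N -> X k.+1 = X k + lambda k *: U k;
  tkgk_US : forall k, (k < K)%N ->
    U k.+1 = D k.+1
             - \sum_(i < k.+1) (tdot (U i) (D k.+1) / tnorm (U i) ^+ 2) *: U i
}.

End Algorithm.

Definition incremental m (pi : nat -> 'S_m) : Prop := forall k, pi k = 1%g.

(* every realization of the random draw is covered: [pi 0] is arbitrary *)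
Definition shuffle_once m (pi : nat -> 'S_m) : Prop := forall k, pi k = pi 0%N.

Section Arnoldi.
Variable R : rcfType.

Definition tcat l p n k (U : nat -> tensor R l p n.+1) :
    tensor R l (\sum_(j < k.+1) p) n.+1 :=
  [ffun t => \mxrow_(j < k.+1) U j t].

Definition hess_mx l p n (C : tensor R l l n.+1) (U : nat -> tensor R l p n.+1)
    (lambda : nat -> R) k : 'M[R]_k.+1 :=
  \matrix_(i, j)
    if (i <= j)%N then tdot (U i) (tprod C (U j)) / tnorm (U i) ^+ 2
    else if i == j.+1 :> nat then - (lambda j)^-1 else 0.

(* the blocks of the Kronecker product of [H] with the identity of size [p] *)
Definition hess_tensor l p n (C : tensor R l l n.+1) (U : nat -> tensor R l p n.+1)
    (lambda : nat -> R) k :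
    tensor R (\sum_(i < k.+1) p) (\sum_(j < k.+1) p) n.+1 :=
  let H := hess_mx C U lambda k in
  [ffun t => if t == 0 then
    \mxblock_(i < k.+1, j < k.+1) ((H i j)%:M : 'M[R]_p) else 0].

Definition last_tensor p n k : tensor R (\sum_(i < k.+1) p) p n.+1 :=
  let e : 'cV[R]_k.+1 := delta_mx ord_max 0 in
  [ffun t => if t == 0 then
    \mxcol_(i < k.+1) ((e i 0)%:M : 'M[R]_p) else 0].

End Arnoldi.

(* Main.v *)
Require Import Defs.
From HB Require Import structures.
From mathcomp Require Import all_boot all_order all_algebra all_fingroup.
From mathcomp Require Import lra.

Set Implicit Arguments.
Unset Strict Implicit.
Unset Printing Implicit Defensive.

Import Order.TTheory GRing.Theory Num.Theory.
Local Open Scope ring_scope.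

(** One sweep [P] of projections satisfies [P X - P Y = T * (X - Y)], so the
    update [X (k+1) = X k + lambda k U k] gives
    [C * U k = (lambda k)^-1 (D k - D (k+1))]. By Gram-Schmidt, [D k] lies in
    the span of [U 0, ..., U k] and [D (k+1)] differs from [U (k+1)] by its
    projection onto that span; since the projection is linear, this is the
    recurrence. The point needing consistency is [lambda k != 0]: for a solution
    [Xs], the Pythagorean identity over a sweep gives
    [<D k, X k - Xs> = - gamma k < 0], whereas the step sizes keep [X k - Xs]
    orthogonal to all previous directions, so [U k] cannot vanish. *)

(** * Algebra of the t-product *)

Section TensorProduct.
Variable R : rcfType.

Lemma tprodE m l p n (A : tensor R m l n.+1) (Y : tensor R l p n.+1) i :
  tprod A Y i = \sum_j A (i - j) *m Y j.
Proof.
rewrite ffunE /bcirc mxblockEv mxcol_mul mxcolK.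
exact: mul_mxrow_mxcol.
Qed.

Lemma unfold_tprod m l p n (A : tensor R m l n.+1) (Y : tensor R l p n.+1) :
  unfold (tprod A Y) = bcirc A *m unfold Y.
Proof. exact: foldK. Qed.

(** Shifting the summation index by [j] turns a block of the matrix product into a cyclic
    convolution. As [bcirc] is injective, identities between t-products can then be checked on
    matrices. *)
Lemma bcirc_tprod m l p n (A : tensor R m l n.+1) (Y : tensor R l p n.+1) :
  bcirc (tprod A Y) = bcirc A *m bcirc Y.
Proof.
rewrite /bcirc mul_mxblock; apply: eq_mxblock => i j.
rewrite tprodE [RHS](reindex_inj (addIr j)).
by apply: eq_bigr => k _; rewrite /= addrK opprD addrA addrAC.
Qed.

Lemma tprodA m l p q n (A : tensor R m l n.+1) (X : tensor R l p n.+1)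
    (Y : tensor R p q n.+1) :
  tprod A (tprod X Y) = tprod (tprod A X) Y.
Proof. by apply: bcirc_inj; rewrite !bcirc_tprod mulmxA. Qed.

Lemma tprodZr m l p n (A : tensor R m l n.+1) a (Y : tensor R l p n.+1) :
  tprod A (a *: Y) = a *: tprod A Y.
Proof.
apply/ffunP=> i; rewrite [RHS]ffunE !tprodE scaler_sumr.
by apply: eq_bigr => j _; rewrite ffunE scalemxAr.
Qed.

Lemma tprodBr m l p n (A : tensor R m l n.+1) (Y Y' : tensor R l p n.+1) :
  tprod A (Y - Y') = tprod A Y - tprod A Y'.
Proof.
apply/ffunP=> i; rewrite [RHS]ffunE [X in _ = _ + X]ffunE !tprodE -sumrB.
by apply: eq_bigr => j _; rewrite !ffunE mulmxBr.
Qed.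

Lemma tprodBl m l p n (A A' : tensor R m l n.+1) (Y : tensor R l p n.+1) :
  tprod (A - A') Y = tprod A Y - tprod A' Y.
Proof.
apply/ffunP=> i; rewrite [RHS]ffunE [X in _ = _ + X]ffunE !tprodE -sumrB.
by apply: eq_bigr => j _; rewrite !ffunE mulmxBl.
Qed.

Lemma tprod1l l p n (Y : tensor R l p n.+1) : tprod (tid R l n) Y = Y.
Proof.
apply/ffunP=> i; rewrite tprodE (bigD1 i) //= ffunE subrr eqxx mul1mx.
rewrite big1 ?addr0 // => j ji.
by rewrite ffunE subr_eq0 eq_sym (negPf ji) mul0mx.
Qed.

(** Lets a solution of the whole system solve each slice equation. *)
Lemma tprod_hslice m l p n (A : tensor R m l n.+1) (Y : tensor R l p n.+1) i :
  tprod (hslice A i) Y = hslice (tprod A Y) i.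
Proof.
apply/ffunP=> t; rewrite tprodE [RHS]ffunE tprodE raddf_sum.
by apply: eq_bigr => j _; rewrite ffunE -row_mul.
Qed.

(** Only one term of the cyclic convolution survives. Both [hess_tensor] and the transpose of
    [last_tensor] have this shape. *)
Lemma tprod_slice0r m l p n (A : tensor R m l n.+1) (M : 'M[R]_(l, p)) t :
  tprod A [ffun s => if s == 0 then M else 0] t = A t *m M.
Proof.
rewrite tprodE (bigD1 0) //= ffunE eqxx subr0 big1 ?addr0 // => j /negPf j0.
by rewrite ffunE j0 mulmx0.
Qed.

End TensorProduct.

(** * The entrywise inner product and its norm *)

Section InnerProduct.
Variable R : rcfType.

Lemma mxdotE a b (M N : 'M[R]_(a, b)) : mxdot M N = \tr (M^T *m N).
Proof.
rewrite /mxdot /mxtrace exchange_big; apply: eq_bigr => j _.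
by rewrite mxE; apply: eq_bigr => i _; rewrite mxE.
Qed.

Lemma mxdot_ge0 a b (M : 'M[R]_(a, b)) : 0 <= mxdot M M.
Proof. by apply: sumr_ge0 => i _; apply: sumr_ge0 => j _; apply: sqr_ge0. Qed.

Lemma sqr_mxnorm a b (M : 'M[R]_(a, b)) : mxnorm M ^+ 2 = mxdot M M.
Proof. by rewrite sqr_sqrtr ?mxdot_ge0. Qed.

Lemma mxdot_mxcol a b q (M N : 'I_q -> 'M[R]_(a, b)) :
  mxdot (\mxcol_i M i) (\mxcol_i N i) = \sum_i mxdot (M i) (N i).
Proof.
rewrite mxdotE tr_mxcol mul_mxrow_mxcol raddf_sum.
by apply: eq_bigr => i _; rewrite mxdotE.
Qed.

Variables m l n : nat.
Implicit Types X Y Z : tensor R m l n.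

Lemma mxdot_unfold X Y : mxdot (unfold X) (unfold Y) = tdot X Y.
Proof. exact: mxdot_mxcol. Qed.

Lemma tdotC X Y : tdot X Y = tdot Y X.
Proof.
apply: eq_bigr => t _; apply: eq_bigr => i _; apply: eq_bigr => j _.
by rewrite mulrC.
Qed.

Lemma tdotDr X Y Z : tdot X (Y + Z) = tdot X Y + tdot X Z.
Proof.
rewrite /tdot -big_split; apply: eq_bigr => t _ /=.
by rewrite !mxdotE ffunE mulmxDr mxtraceD.
Qed.

Lemma tdotZr X a Y : tdot X (a *: Y) = a * tdot X Y.
Proof.
rewrite /tdot mulr_sumr; apply: eq_bigr => t _.
by rewrite !mxdotE ffunE -scalemxAr mxtraceZ.
Qed.

Lemma tdot0r X : tdot X 0 = 0.
Proof. by rewrite -(scale0r 0) tdotZr mul0r. Qed.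

Lemma tdotNr X Y : tdot X (- Y) = - tdot X Y.
Proof. by rewrite -scaleN1r tdotZr mulN1r. Qed.

Lemma tdotBr X Y Z : tdot X (Y - Z) = tdot X Y - tdot X Z.
Proof. by rewrite tdotDr tdotNr. Qed.

Lemma tdot_sumr X q (F : 'I_q -> tensor R m l n) :
  tdot X (\sum_i F i) = \sum_i tdot X (F i).
Proof. exact: (big_morph _ (tdotDr X) (tdot0r X)). Qed.

Lemma tdot_ge0 X : 0 <= tdot X X.
Proof. by apply: sumr_ge0 => t _; apply: mxdot_ge0. Qed.

Lemma tdot_eq0 X : (tdot X X == 0) = (X == 0).
Proof.
apply/idP/eqP => [|->]; last by rewrite tdot0r.
rewrite psumr_eq0 => [/allP X0|t _]; last exact: mxdot_ge0.
apply/ffunP=> t; apply/matrixP=> i j; rewrite ffunE mxE.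
have := X0 t (mem_index_enum _); rewrite psumr_eq0 => [/allP Xt0|? _]; last first.
  by apply: sumr_ge0 => ? _; apply: sqr_ge0.
have := Xt0 i (mem_index_enum _); rewrite psumr_eq0 => [/allP Xi0|? _]; last first.
  exact: sqr_ge0.
by have := Xi0 j (mem_index_enum _); rewrite -expr2 sqrf_eq0 => /eqP.
Qed.

Lemma sqr_tnorm X : tnorm X ^+ 2 = tdot X X.
Proof. by rewrite sqr_sqrtr ?tdot_ge0. Qed.

Lemma tdotDl X Y Z : tdot (X + Y) Z = tdot X Z + tdot Y Z.
Proof. by rewrite !(tdotC _ Z) tdotDr. Qed.

Lemma tdot_sqrD X Y : tdot (X + Y) (X + Y) = tdot X X + tdot X Y *+ 2 + tdot Y Y.
Proof. by rewrite tdotDr !tdotDl (tdotC Y X) mulr2n !addrA. Qed.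

Lemma tdot_sqrB X Y : tdot (X - Y) (X - Y) = tdot X X - tdot X Y *+ 2 + tdot Y Y.
Proof. by rewrite tdot_sqrD !tdotNr mulNrn (tdotC (- Y)) tdotNr opprK. Qed.

End InnerProduct.

Lemma tdot_tprodl (R : rcfType) m l p n (M : tensor R m l n.+1)
    (X : tensor R l p n.+1) (Y : tensor R m p n.+1) :
  tdot (tprod M X) Y = tdot X (tprod (ttr M) Y).
Proof.
by rewrite -!mxdot_unfold !unfold_tprod bcirc_ttr !mxdotE trmx_mul mulmxA.
Qed.

(** * Gram-Schmidt orthogonalization without truncation *)

Section GramSchmidt.
Variables (R : rcfType) (m l n : nat).
Implicit Types (U D : nat -> tensor R m l n) (V : tensor R m l n).

Definition gs_proj U j V : tensor R m l n :=
  \sum_(i < j) (tdot (U i) V / tnorm (U i) ^+ 2) *: U i.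

Lemma gs_projZB U j a V W :
  gs_proj U j (a *: (V - W)) = a *: (gs_proj U j V - gs_proj U j W).
Proof.
rewrite /gs_proj -sumrB scaler_sumr; apply: eq_bigr => i _.
by rewrite tdotZr tdotBr -scalerBl scalerA -mulrBl mulrA.
Qed.

(* Division by zero is harmless: both sides vanish when [X = 0]. *)
Lemma gs_coefK (X V : tensor R m l n) :
  tdot X V / tnorm X ^+ 2 * tdot X X = tdot X V.
Proof.
rewrite sqr_tnorm; have [X0|X0] := eqVneq (tdot X X) 0; last by rewrite divfK.
move/eqP: (X0); rewrite tdot_eq0 => /eqP ->.
by rewrite (tdotC 0 V) !tdot0r mulr0.
Qed.

Lemma tdot_gs_proj_ortho U V W j :
  (forall i, (i < j)%N -> tdot W (U i) = 0) -> tdot W (gs_proj U j V) = 0.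
Proof.
move=> WU; rewrite tdot_sumr big1 // => i _.
by rewrite tdotZr WU ?mulr0.
Qed.

Variables (U D : nat -> tensor R m l n) (K : nat).
Hypothesis GS : forall j, (j <= K)%N -> U j = D j - gs_proj U j (D j).

(** Strong induction on the larger index: among the subtracted terms only the one along [U i] meets
    [U i], and it cancels the component of [D j]. *)
Lemma gs_orthogonal i j : (i < j <= K)%N -> tdot (U i) (U j) = 0.
Proof.
have [N] := ubnP j; elim: N i j => // N IH i j; rewrite ltnS => jN /andP[ij jK].
rewrite (GS jK) tdotBr tdot_sumr (bigD1 (Ordinal ij)) //= tdotZr.
rewrite gs_coefK big1 ?addr0 ?subrr // => k /negP ki; rewrite tdotZr.
have kj := ltn_ord k.
have [ik|ki'|ik] := ltngtP i k.
- by rewrite IH ?mulr0 ?ik ?(leq_trans kj jN) ?(ltnW (leq_trans kj jK)).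
- by rewrite (tdotC (U i)) IH ?mulr0 ?ki' ?(leq_trans ij jN) ?(ltnW (leq_trans ij jK)).
- by case: ki; apply/eqP/val_inj.
Qed.

Lemma tdot_gs_step V j : (j <= K)%N ->
  (forall i, (i < j)%N -> tdot V (U i) = 0) -> tdot V (D j) = tdot V (U j).
Proof.
by move=> jK VU; rewrite (GS jK) tdotBr tdot_gs_proj_ortho ?subr0.
Qed.

(** By orthogonality the component of [D j] along [U j] is [U j] itself, and the earlier components
    are exactly what Gram-Schmidt subtracted. *)
Lemma gs_proj_self j : (j <= K)%N -> gs_proj U j.+1 (D j) = D j.
Proof.
move=> jK.
have coefU : (tdot (U j) (D j) / tnorm (U j) ^+ 2) *: U j = U j.
  rewrite (@tdot_gs_step (U j)) // => [|i ij]; last first.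
    by rewrite tdotC gs_orthogonal ?ij.
  rewrite sqr_tnorm; have [->|U0] := eqVneq (U j) 0; first by rewrite scaler0.
  by rewrite divff ?scale1r // tdot_eq0.
by rewrite /gs_proj big_ord_recr /= coefU (GS jK) addrC subrK.
Qed.

End GramSchmidt.

(** * Row projections, full sweeps and the Pythagorean identity *)

Section Projections.
Variables (R : rcfType) (m l p n : nat).
Variables (A : tensor R m l n.+1) (B : tensor R m p n.+1).
Implicit Types (s : 'S_m) (X Y : tensor R l p n.+1).

(** Under [bcirc] this is the orthogonal projector onto the row space of the slice. *)
Definition kproj i : tensor R l l n.+1 := tprod (tpinv (hslice A i)) (hslice A i).

Lemma kproj_idem i : tprod (kproj i) (kproj i) = kproj i.
Proof.
apply: bcirc_inj; rewrite !bcirc_tprod bcirc_tpinv.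
by case/and4P: (pinvP (bcirc (hslice A i))) => _ /eqP e _ _; rewrite mulmxA e.
Qed.

Lemma kproj_sym i : ttr (kproj i) = kproj i.
Proof.
apply: bcirc_inj; rewrite bcirc_ttr !bcirc_tprod bcirc_tpinv.
by case/and4P: (pinvP (bcirc (hslice A i))) => _ _ _ /eqP.
Qed.

Lemma projB i X Y :
  proj A B i X - proj A B i Y = tprod (tid R l n - kproj i) (X - Y).
Proof.
rewrite /proj tprodBl tprod1l /kproj -tprodA !tprodBr.
by rewrite [X in _ + X = _]opprD addrACA -opprD [X in _ - (_ + X)]opprB addrA subrK.
Qed.

(** Each projection is affine, so [B] cancels in differences. The projection applied last gives the
    leftmost factor, hence the reversed list. *)
Lemma foldl_projB t X Y :
  foldl (fun Z i => proj A B i Z) X t - foldl (fun Z i => proj A B i Z) Y t =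
  tprod (\big[@tprod R l l l n/tid R l n]_(i <- rev t) (tid R l n - kproj i))
    (X - Y).
Proof.
elim/last_ind: t => [|t i IH]; first by rewrite big_nil tprod1l.
by rewrite !foldl_rcons rev_rcons big_cons projB IH tprodA.
Qed.

Lemma proj_uptoS s (i : 'I_m) X :
  proj_upto A B s i.+1 X = proj A B (s i) (proj_upto A B s i X).
Proof.
rewrite /proj_upto (take_nth (s i)); last by rewrite size_map size_enum_ord.
have e : nth (s i) [seq s j | j <- enum 'I_m] i = s i.
  by rewrite (nth_map i) ?size_enum_ord ?nth_ord_enum.
by rewrite [LHS]foldl_rcons e.
Qed.

Lemma rev_map_enum_ord (T : Type) q (f : 'I_q -> T) :
  rev [seq f i | i <- enum 'I_q] = [seq f (rev_ord i) | i <- enum 'I_q].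
Proof.
rewrite -map_rev (map_comp f (@rev_ord q)); congr map.
apply: (inj_map val_inj); rewrite map_rev val_enum_ord -map_comp.
apply: (@eq_from_nth _ 0) => [|i]; rewrite size_rev size_iota.
  by rewrite size_map size_enum_ord.
move=> iq; rewrite nth_rev ?size_iota // nth_iota ?add0n; last first.
  by rewrite subnSK // leq_subr.
by rewrite (nth_map (Ordinal iq)) ?size_enum_ord //= nth_enum_ord.
Qed.

Lemma TpermE s :
  Tperm A s =
  \big[@tprod R l l l n/tid R l n]_(i <- rev [seq s i | i <- enum 'I_m])
    (tid R l n - kproj i).
Proof. by rewrite rev_map_enum_ord big_map enumT. Qed.

Lemma proj_permB s X Y :
  proj_perm A B s X - proj_perm A B s Y = tprod (Tperm A s) (X - Y).
Proof.
rewrite /proj_perm /proj_upto take_oversize; last by rewrite size_map size_enum_ord.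
by rewrite TpermE foldl_projB.
Qed.

Variable Xs : tensor R l p n.+1.
Hypothesis solution : tprod A Xs = B.

(** Consistency enters here: the residual of a slice is the slice applied to the error, so the
    correction is an orthogonal projection of the error. *)
Lemma proj_step i X :
  tprod (tpinv (hslice A i)) (tprod (hslice A i) X - hslice B i) =
  tprod (kproj i) (X - Xs).
Proof. by rewrite -solution -tprod_hslice -tprodBr tprodA. Qed.

Lemma proj_pythagoras i X :
  let r := tprod (kproj i) (X - Xs) in
  tdot r r = tdot (X - Xs) (X - Xs) - tdot (proj A B i X - Xs) (proj A B i X - Xs).
Proof.
rewrite /proj proj_step addrAC; set Z := X - Xs; set r := tprod _ Z => /=.
(* A symmetric idempotent makes [r] orthogonal to [Z - r], which is the new error. *)
have rr : tdot r Z = tdot r r.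
  by rewrite {3}/r (tdotC r) tdot_tprodl kproj_sym tprodA kproj_idem tdotC.
rewrite (tdot_sqrB Z r) (tdotC Z r) rr.
by move: (tdot Z Z) (tdot r r) => z q; lra.
Qed.

Lemma sqr_rperm s X :
  mxnorm (rperm A B s X) ^+ 2 =
  tdot (X - Xs) (X - Xs)
  - tdot (proj_perm A B s X - Xs) (proj_perm A B s X - Xs).
Proof.
(* The minus sign turns each decrease of the squared error into an increment [N i.+1 - N i], so that
   the sum telescopes. *)
pose N j := - tdot (proj_upto A B s j X - Xs) (proj_upto A B s j X - Xs).
rewrite sqr_mxnorm mxdot_mxcol.
rewrite (eq_bigr (fun i : 'I_m => N i.+1 - N i)); last first.
  move=> i _; rewrite mxdot_unfold proj_step proj_pythagoras /N opprK addrC.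
  by rewrite proj_uptoS.
rewrite -(big_mkord xpredT (fun i => N i.+1 - N i)) telescope_sumr //.
by rewrite /N opprK addrC /proj_upto take0.
Qed.

(* Twice this equation is the Pythagorean identity for one full sweep. *)
Lemma tdot_proj_perm s X :
  let D := proj_perm A B s X - X in
  tdot D (X - Xs) = - (2^-1 * (mxnorm (rperm A B s X) ^+ 2 + tnorm D ^+ 2)).
Proof.
move=> D; rewrite sqr_rperm sqr_tnorm.
have -> : proj_perm A B s X - Xs = D + (X - Xs) by rewrite addrA subrK.
rewrite (tdot_sqrD D).
by move: (tdot D D) (tdot D _) (tdot (X - Xs) _) => d c z; lra.
Qed.

End Projections.


(** * From the vector recurrences to the block decomposition *)

Section Arnoldi.
Variables (R : rcfType) (l p n k : nat).

Lemma tprod_tcat (C : tensor R l l n.+1) (U : nat -> tensor R l p n.+1) :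
  tprod C (tcat k U) = tcat k (fun j => tprod C (U j)).
Proof.
apply/ffunP=> t; rewrite tprodE [RHS]ffunE.
rewrite (eq_bigr (fun s => \mxrow_(j < k.+1) (C (t - s) *m U j s))); last first.
  by move=> s _; rewrite ffunE mul_mxrow.
rewrite -mxrow_sum; apply: eq_mxrow => j.
by rewrite tprodE.
Qed.

Lemma tcat_hess_tensor (C : tensor R l l n.+1) (U : nat -> tensor R l p n.+1) lambda :
  tprod (tcat k U) (hess_tensor C U lambda k) =
  [ffun t => \mxrow_(j < k.+1) \sum_i hess_mx C U lambda k i j *: U i t].
Proof.
apply/ffunP=> t; rewrite tprod_slice0r !ffunE mul_mxrow_mxblock.
apply: eq_mxrow => j; apply: eq_bigr => i _; exact: mul_mx_scalar.
Qed.

Lemma tprod_last_tensorT (V : tensor R l p n.+1) :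
  tprod V (ttr (last_tensor R p n k)) =
  [ffun t => \mxrow_(j < k.+1) if j == ord_max then V t else 0].
Proof.
(* The transposed Kronecker factor as a block row; [ttr] negates the slice index, which fixes slice
   0. *)
pose M := \mxrow_(j < k.+1) ((j == ord_max)%:R%:M : 'M[R]_p).
have -> : ttr (last_tensor R p n k) = [ffun t => if t == 0 then M else 0].
  apply/ffunP=> t; rewrite !ffunE oppr_eq0; case: (t == 0); last exact: trmx0.
  rewrite tr_mxcol; apply: eq_mxrow => j.
  by rewrite tr_scalar_mx mxE eqxx andbT.
apply/ffunP=> t; rewrite tprod_slice0r ffunE mul_mxrow; apply: eq_mxrow => j.
by rewrite mul_mx_scalar; case: eqP => _; rewrite ?scale1r ?scale0r.
Qed.

(* The Hessenberg shape of the coefficients truncates the sum in column [j] at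
   [i <= j.+1], and the entry [i = k.+1] falls outside of the matrix. *)
Lemma arnoldi_of_recurrence (C : tensor R l l n.+1) (U : nat -> tensor R l p n.+1)
    (lambda : nat -> R) :
  (forall j, (j <= k)%N -> tprod C (U j) =
     \sum_(i < j.+1) (tdot (U i) (tprod C (U j)) / tnorm (U i) ^+ 2) *: U i
     - (lambda j)^-1 *: U j.+1) ->
  tprod C (tcat k U) =
    tprod (tcat k U) (hess_tensor C U lambda k)
    + tprod (- (lambda k)^-1 *: U k.+1) (ttr (last_tensor R p n k)).
Proof.
move=> rec; rewrite tprod_tcat tcat_hess_tensor tprod_last_tensorT.
apply/ffunP=> t; rewrite [RHS]ffunE ![in RHS]ffunE [LHS]ffunE -mxrowD.
apply: eq_mxrow => j; set c := fun i => tdot (U i) (tprod C (U j)) / tnorm (U i) ^+ 2.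
have jk : (j <= k)%N by rewrite -ltnS.
have recj : tprod C (U j) t = \sum_(i < j.+1) c i *: U i t - (lambda j)^-1 *: U j.+1 t.
  rewrite {1}rec // ffunE sum_ffunE ffunE ffunE.
  by congr (_ - _); apply: eq_bigr => i _; rewrite ffunE.
(* Column [j] of the Hessenberg matrix, extended to all natural indices so that the sum can be cut
   at [j.+1]. *)
pose h i := if (i <= j)%N then c i else if i == j.+1 then - (lambda j)^-1 else 0.
rewrite recj (eq_bigr (fun i : 'I_k.+1 => h i *: U i t)); last first.
  by move=> i _; rewrite mxE.
rewrite -(big_mkord xpredT (fun i => h i *: U i t)).
rewrite (@big_cat_nat _ _ _ j.+1) //= big_mkord -addrA; congr (_ + _).
  by apply: eq_bigr => i _; rewrite /h -ltnS ltn_ord.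
(* In the last column the tail of the sum is empty and the remainder term supplies [U k.+1]; in the
   others the tail starts with the subdiagonal entry. *)
have [->|jmax] := eqVneq j ord_max; first by rewrite big_geq // add0r scaleNr.
rewrite addr0 big_ltn; last first.
  by rewrite ltnS ltn_neqAle jk andbT; apply: contra jmax => /eqP jk0; apply/eqP/val_inj.
rewrite {1}/h ltnn eqxx scaleNr big_nat big1 ?addr0 // => i /andP[ji _].
by rewrite /h leqNgt (ltnW ji) eq_sym (ltn_eqF ji) scale0r.
Qed.

End Arnoldi.

(** * The iteration: nonzero steps and the recurrence *)

Section Run.
Variables (R : rcfType) (m l p n : nat).
Variables (A : tensor R m l n.+1) (B : tensor R m p n.+1) (X0 : tensor R l p n.+1).
Variables (pi : nat -> 'S_m) (K : nat) (X D U : nat -> tensor R l p n.+1).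
Variable lambda : nat -> R.
Hypothesis run : tkgk_run A B X0 pi K X D U lambda.

Lemma tkgk_gram_schmidt j : (j <= K)%N -> U j = D j - gs_proj U j (D j).
Proof.
case: j => [_|j jK]; last exact: (tkgk_US run).
by rewrite /gs_proj big_ord0 subr0 (tkgk_U0 run).
Qed.

Variable Xs : tensor R l p n.+1.
Hypothesis solution : tprod A Xs = B.

Let gamma k := 2^-1 * (mxnorm (rperm A B (pi k) (X k)) ^+ 2 + tnorm (D k) ^+ 2).

Lemma tkgk_tdot_error k : (k <= K)%N -> tdot (D k) (X k - Xs) = - gamma k.
Proof. by move=> kK; rewrite /gamma (tkgk_D run) // (tdot_proj_perm solution). Qed.

Lemma tkgk_gamma_gt0 k : (k <= K)%N -> 0 < gamma k.
Proof.
move=> kK; rewrite mulr_gt0 ?invr_gt0 ?ltr0n // ltr_wpDl ?sqr_ge0 //.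
by rewrite sqr_tnorm lt_def tdot_ge0 tdot_eq0 (tkgk_nostop run).
Qed.

(* If [U k] vanished, [D k] would lie in the span of the previous directions,
   to which the error is orthogonal, against [<D k, X k - Xs> = - gamma k < 0]. *)
Lemma tkgk_U_neq0 k : (k <= K)%N ->
  (forall i, (i < k)%N -> tdot (X k - Xs) (U i) = 0) -> U k != 0.
Proof.
move=> kK orth; apply: contraTneq (tkgk_gamma_gt0 kK) => Uk0.
have := tkgk_tdot_error kK.
rewrite tdotC (tdot_gs_step tkgk_gram_schmidt) // Uk0 tdot0r.
by move/eqP; rewrite eq_sym oppr_eq0 => /eqP ->; rewrite ltxx.
Qed.

(* The exact step size makes the new error orthogonal to the last direction. *)
Lemma tkgk_error_orthogonal k i :
  (i < k <= K)%N -> tdot (X k - Xs) (U i) = 0.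
Proof.
elim: k i => // k IH i /andP[ik kK].
have orth a : (a < k)%N -> tdot (X k - Xs) (U a) = 0.
  by move=> ak; rewrite IH // ak ltnW.
rewrite (tkgk_XS run) // addrAC tdotDl (tdotC (lambda k *: U k)) tdotZr.
move: ik; rewrite ltnS leq_eqVlt => /orP[/eqP->|ik]; last first.
  have UU : tdot (U i) (U k) = 0.
    by apply: (gs_orthogonal tkgk_gram_schmidt); rewrite ik ltnW.
  by rewrite orth // UU mulr0 addr0.
(* Orthogonality to earlier directions allows replacing [U k] by [D k], whose product with the error
   is [- gamma k]. The step contributes [+ gamma k], provided [U k] is nonzero, which the same
   orthogonality ensures. *)
rewrite -(tdot_gs_step tkgk_gram_schmidt) ?(ltnW kK) // tdotC.
rewrite tkgk_tdot_error ?(ltnW kK) // (tkgk_lambda run) // -/(gamma k) sqr_tnorm.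
by rewrite divfK ?addNr // tdot_eq0 tkgk_U_neq0 // ltnW.
Qed.

Lemma tkgk_lambda_neq0 k : (k < K)%N -> lambda k != 0.
Proof.
move=> kK; have kK' := ltnW kK.
rewrite (tkgk_lambda run) // -/(gamma k); apply: mulf_neq0.
  by rewrite gt_eqF ?tkgk_gamma_gt0.
rewrite invr_eq0 sqr_tnorm tdot_eq0 tkgk_U_neq0 // => i ik.
by rewrite tkgk_error_orthogonal ?ik.
Qed.

Hypothesis pi_const : forall k, pi k = pi 0%N.
Let C := tid R l n - Tperm A (pi 0%N).

Lemma tkgk_C_direction k : (k < K)%N ->
  tprod C (U k) = (lambda k)^-1 *: (D k - D k.+1).
Proof.
(* A nonzero [lambda k] allows writing [U k] as a multiple of the increment [X k.+1 - X k], on which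
   [Tperm] acts as the difference of two sweeps. *)
move=> kK; rewrite -[U k](scalerK (tkgk_lambda_neq0 kK)) tprodZr; congr (_ *: _).
have -> : lambda k *: U k = X k.+1 - X k by rewrite (tkgk_XS run) // addrAC subrr add0r.
rewrite (tkgk_D run kK) (tkgk_D run (ltnW kK)) !pi_const.
rewrite /C tprodBl tprod1l -(proj_permB A B).
by rewrite !opprB addrACA [RHS]addrACA [X in X + _ = _]addrC.
Qed.

Lemma tkgk_recurrence k : (k < K)%N ->
  tprod C (U k) =
    \sum_(i < k.+1) (tdot (U i) (tprod C (U k)) / tnorm (U i) ^+ 2) *: U i
    - (lambda k)^-1 *: U k.+1.
Proof.
move=> kK; rewrite -/(gs_proj U k.+1 (tprod C (U k))) tkgk_C_direction //.
(* The projection fixes [D k] and sends [D k.+1] to [D k.+1 - U k.+1]. *)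
rewrite gs_projZB (gs_proj_self tkgk_gram_schmidt) ?(ltnW kK) // -scalerBr.
by rewrite (tkgk_gram_schmidt kK) opprB [in RHS]addrA subrK.
Qed.

End Run.

Theorem mainTheorem5 (R : rcfType) (m l p n : nat)
    (A : tensor R m l n.+1) (B : tensor R m p n.+1) (X0 : tensor R l p n.+1)
    (pi : nat -> 'S_m) (X D U : nat -> tensor R l p n.+1) (lambda : nat -> R)
    (k : nat)
    (consistent : exists Xs : tensor R l p n.+1, tprod A Xs = B)
    (strategy : incremental pi \/ shuffle_once pi)
    (run : tkgk_run A B X0 pi k.+1 X D U lambda) :
  let C : tensor R l l n.+1 := tid R l n - Tperm A (pi 0%N) in
  let Rk : tensor R l p n.+1 := - (lambda k)^-1 *: U k.+1 in
  tprod C (U k) =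
    \sum_(i < k.+1) (tdot (U i) (tprod C (U k)) / tnorm (U i) ^+ 2) *: U i
    - (lambda k)^-1 *: U k.+1
  /\
  tprod C (tcat k U) =
    tprod (tcat k U) (hess_tensor C U lambda k)
    + tprod Rk (ttr (last_tensor R p n k)).
Proof.
have [Xs solution] := consistent.
have pi_const j : pi j = pi 0%N by case: strategy => pi_eq; rewrite ?pi_eq.
have rec := tkgk_recurrence run solution pi_const.
(* The run reaches index [k.+1], so the recurrence is available for every column [j <= k]. *)
by split; [exact: rec | apply: arnoldi_of_recurrence => j jk; exact: rec].
Qed.
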